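(* Let $\Delta=\{x\in\mathbb{R}^d:x_i\ge0,\ \sum_i x_i=1\}$ be the unit simplex. Then $\Delta$ is monotone for all $d\ge1$; i.e., for every $c=(c_1,\dots,c_d)\in\mathbb{R}^d$, the support of the soft-min $x^\delta$ (respectively $x_\eta$) decreases monotonically to $\operatorname{argmin}c$ as $\delta\in[\delta_{\min},\delta_{\max}]$ (respectively $\eta\ge0$) increases.
   Context: $\mathbb{R}^d$ carries the standard Euclidean inner product and norm. $\operatorname{argmin}c=\{i:c_i=\min_j c_j\}$ and $\operatorname{spt}x=\{i:x_i\neq0\}$. For a nonempty polytope $\mathcal{P}\subset\mathbb{R}^d$ and $c\in\mathbb{R}^d$: let $\mathcal{P}(\delta)=\{x\in\mathcal{P}:\|x\|\le\delta\}$, $\delta_{\min}=\min\{\delta\ge0:\mathcal{P}(\delta)\ne\emptyset\}$, $\delta_{\max}=\min\{\delta\ge0:\min_{x\in\mathcal{P}(\delta)}\langle c,x\rangle=\min_{x\in\mathcal{P}}\langle c,x\rangle\}$. For $\delta\in[\delta_{\min},\delta_{\max}]$, $x^\delta$ is the unique minimizer of $\langle c,x\rangle$ over $\mathcal{P}(\delta)$. For $\eta\in(0,\infty)$, $x_\eta$ is the unique minimizer of $\langle c,x\rangle+\frac1{2\eta}\|x\|^2$ over $\mathcal{P}$; $x_0$ is the minimum-norm point of $\mathcal{P}$, and $x_\infty=\lim_{\eta\to\infty}x_\eta$. The soft-min is the case $\mathcal{P}=\Delta$. A face of $\mathcal{P}$ is a convex subset $F\subset\mathcal{P}$ such that any open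 line segment $L=(x,y)\subset\mathcal{P}$ with $L\cap F\neq\emptyset$ satisfies $[x,y]\subset F$. $\mathcal{P}$ is $c$-monotone if for any face $F$: $x^\delta\in F$ implies $x^{\delta'}\in F$ for all $\delta'\ge\delta$ in $[\delta_{\min},\delta_{\max}]$; equivalently, $x_\eta\in F$ implies $x_{\eta'}\in F$ for all $\eta'\ge\eta$ in $[0,\infty]$. $\mathcal{P}$ is monotone if it is $c$-monotone for all $c\in\mathbb{R}^d$. ''Decreases monotonically to $\operatorname{argmin}c$'' means: $\operatorname{spt}x^{\delta'}\subset\operatorname{spt}x^{\delta}$ for $\delta\le\delta'$ in $[\delta_{\min},\delta_{\max}]$, with $\operatorname{spt}x^{\delta_{\max}}=\operatorname{argmin}c$; respectively $\operatorname{spt}x_{\eta'}\subset\operatorname{spt}x_\eta$ for $0\le\eta\le\eta'$, with $\operatorname{spt}x_\eta=\operatorname{argmin}c$ for all sufficiently large $\eta$. *)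

(* Defs.v *)
From mathcomp Require Import all_boot all_order all_algebra.
From mathcomp Require Import all_classical all_reals all_analysis.

Set Implicit Arguments.
Unset Strict Implicit.
Unset Printing Implicit Defensive.

Import Order.TTheory GRing.Theory Num.Theory.
Import numFieldNormedType.Exports.

Local Open Scope classical_set_scope.
Local Open Scope ring_scope.

(* Junk-value conventions: [minimum] and [unique_minimizer] return 0 when the
   minimum, resp. the unique minimizer, does not exist. *)

Definition is_minimum {R : realType} (A : set R) (m : R) : Prop :=
  A m /\ forall a, A a -> m <= a.

Definition minimum {R : realType} (A : set R) : R :=
  xget 0 [set m | is_minimum A m].

Section Polytopes.
Context {R : realType} {d : nat}.
Implicit Types (P F : set 'rV[R]_d) (x y c : 'rV[R]_d) (delta : R).

Definition dot x y : R := \sum_(i < d) x 0 i * y 0 i.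

(* The library norm [`|x|] on row vectors is the sup norm, so the Euclidean
   norm is defined separately. *)
Definition enorm x : R := Num.sqrt (dot x x).

Definition spt x : set 'I_d := [set i | x 0 i != 0].

Definition argmin c : set 'I_d :=
  [set i | c 0 i = minimum [set c 0 j | j in [set: 'I_d]]].

Definition minimizers (f : 'rV[R]_d -> R) (A : set 'rV[R]_d) : set 'rV[R]_d :=
  [set x | A x /\ forall y, A y -> f x <= f y].

Definition unique_minimizer (f : 'rV[R]_d -> R) (A : set 'rV[R]_d) : 'rV[R]_d :=
  xget 0 [set x | minimizers f A = [set x]].

Definition convex_hull (n : nat) (v : 'I_n -> 'rV[R]_d) : set 'rV[R]_d :=
  [set x : 'rV[R]_d | exists a : 'I_n -> R,
     [/\ forall i, 0 <= a i, \sum_(i < n) a i = 1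
       & x = \sum_(i < n) a i *: v i]].

Definition is_polytope P : Prop :=
  exists n (v : 'I_n -> 'rV[R]_d), P = convex_hull v.

Definition open_segment x y : set 'rV[R]_d :=
  [set (1 - t) *: x + t *: y | t in [set t : R | 0 < t < 1]].

Definition closed_segment x y : set 'rV[R]_d :=
  [set (1 - t) *: x + t *: y | t in [set t : R | 0 <= t <= 1]].

Definition is_face P F : Prop :=
  [/\ @convex_set R 'rV[R]_d F, F `<=` P
    & forall x y, open_segment x y `<=` P ->
        open_segment x y `&` F !=set0 -> closed_segment x y `<=` F].

Definition norm_le P delta : set 'rV[R]_d := [set x | P x /\ enorm x <= delta].

Definition delta_min P : R :=
  minimum [set delta | 0 <= delta /\ norm_le P delta !=set0].

(* Both minima are required to exist: comparing values of [minimum] would admit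
   spurious [delta] with [norm_le P delta] empty. *)
Definition delta_max P c : R :=
  minimum [set delta | 0 <= delta /\
    exists2 m, is_minimum [set dot c x | x in norm_le P delta] m
             & is_minimum [set dot c x | x in P] m].

Definition x_delta P c delta : 'rV[R]_d :=
  unique_minimizer (dot c) (norm_le P delta).

Definition x_fin P c (eta : R) : 'rV[R]_d :=
  if eta == 0 then unique_minimizer enorm P
  else unique_minimizer
         (fun x => dot c x + (2 * eta)^-1 * enorm x ^+ 2) P.

(* The value at [-oo] is junk; only [0 <= eta] is ever used. *)
Definition x_eta P c (eta : \bar R) : 'rV[R]_d :=
  match eta with
  | r%:E => x_fin P c r
  | +oo%E => lim (x_fin P c r @[r --> +oo%R])
  | -oo%E => 0
  end.

Definition c_monotone P c : Prop :=
  forall F, is_face P F ->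
  forall delta delta', delta_min P <= delta -> delta <= delta' ->
    delta' <= delta_max P c ->
    F (x_delta P c delta) -> F (x_delta P c delta').

Definition c_monotone_eta P c : Prop :=
  forall F, is_face P F ->
  forall eta eta' : \bar R, (0 <= eta)%E -> (eta <= eta')%E ->
    F (x_eta P c eta) -> F (x_eta P c eta').

(* Monotonicity is a property of nonempty polytopes. *)
Definition monotone_polytope P : Prop :=
  [/\ is_polytope P, P !=set0 & forall c, c_monotone P c].

Definition monotone_polytope_eta P : Prop :=
  [/\ is_polytope P, P !=set0 & forall c, c_monotone_eta P c].

Definition spt_delta_decreases_to_argmin P c : Prop :=
  (forall delta delta', delta_min P <= delta -> delta <= delta' ->
     delta' <= delta_max P c ->
     spt (x_delta P c delta') `<=` spt (x_delta P c delta)) /\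
  spt (x_delta P c (delta_max P c)) = argmin c.

Definition spt_eta_decreases_to_argmin P c : Prop :=
  (forall eta eta' : R, 0 <= eta -> eta <= eta' ->
     spt (x_eta P c eta'%:E) `<=` spt (x_eta P c eta%:E)) /\
  exists2 eta0 : R, 0 <= eta0 &
    forall eta : R, eta0 <= eta -> spt (x_eta P c eta%:E) = argmin c.

End Polytopes.

Definition simplex (R : realType) (d : nat) : set 'rV[R]_d :=
  [set x : 'rV[R]_d | (forall i, 0 <= x 0 i) /\ \sum_(i < d) x 0 i = 1].

Arguments simplex : clear implicits.

(* Main.v *)
(* Up to scaling, the soft-min has an explicit form: with [g_i = c_i - min c] and
   [u >= 0], let [w_i(u) = max(0, 1 - u g_i)] and [x(u) = w(u) / sum w(u)].  The
   KKT conditions identify [x(u)] both with [x_eta] for [eta = u / sum w(u)] and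
   with [x^delta] for [delta = |x(u)|]; both are continuous nondecreasing
   functions of [u], so the intermediate value theorem shows that every
   admissible [eta] and [delta] is reached.  The support of [x(u)] is
   [{i : u g_i < 1}], which visibly decreases in [u] and equals [argmin c] for
   large [u].  Finally, on the simplex, membership of a point in a face depends
   monotonically on its support. *)

Require Import Defs.
From mathcomp Require Import all_boot all_order all_algebra.
From mathcomp Require Import all_classical all_reals all_analysis.
From mathcomp Require Import ring lra.

Set Implicit Arguments.
Unset Strict Implicit.
Unset Printing Implicit Defensive.

Import Order.TTheory GRing.Theory Num.Theory.
Import numFieldNormedType.Exports.

Local Open Scope classical_set_scope.
Local Open Scope ring_scope.

(** * Minima, the Euclidean norm and unique minimizers *)

Lemma minimumE (R : realType) (A : set R) (m : R) :
  is_minimum A m -> minimum A = m.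
Proof.
move=> [Am minm]; apply: xget_unique => // y [Ay miny].
by apply/eqP; rewrite eq_le miny // minm.
Qed.

Section Dot.
Context {R : realType} {d : nat}.
Implicit Types x y : 'rV[R]_d.

Lemma dot_ge0 x : 0 <= dot x x.
Proof. by apply: sumr_ge0 => i _; rewrite -expr2 sqr_ge0. Qed.

Lemma dot_eq0 x : dot x x <= 0 -> x = 0.
Proof.
move=> x0; apply/rowP => i; rewrite mxE.
have /psumr_eq0P : dot x x = 0 by apply/eqP; rewrite eq_le x0 dot_ge0.
have nneg j : true -> 0 <= x 0 j * x 0 j by rewrite -expr2 sqr_ge0.
by move=> /(_ nneg i isT)/eqP; rewrite mulf_eq0 orbb => /eqP.
Qed.

Lemma enorm_sqr x : enorm x ^+ 2 = dot x x.
Proof. by rewrite sqr_sqrtr // dot_ge0. Qed.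

Lemma enorm_ge0 x : 0 <= enorm x.
Proof. exact: sqrtr_ge0. Qed.

Lemma ler_enorm x y : (enorm x <= enorm y) = (dot x x <= dot y y).
Proof. by rewrite ler_sqrt // dot_ge0. Qed.

(** The hypothesis yields existence as well as uniqueness: a point strictly better than [x] would
    have to be [x] itself, so no compactness argument is involved. *)
Lemma unique_minimizerE (f : 'rV[R]_d -> R) A x :
  A x -> (forall y, A y -> f y <= f x -> y = x) ->
  unique_minimizer f A = x.
Proof.
move=> Ax xmin; have minx : minimizers f A = [set x].
  apply/seteqP; split => [y [Ay ymin]|y ->]; first exact/xmin/ymin.
  split=> // y' Ay'; rewrite leNgt; apply/negP => lt_y'.
  by move: (lt_y'); rewrite (xmin _ Ay' (ltW lt_y')) ltxx.
apply: xget_unique => // y; rewrite /= minx => xy.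
by have : [set y] y by []; rewrite -xy.
Qed.

End Dot.

(** * The simplex as a polytope, and its faces *)

Section Simplex.
Context {R : realType} {d : nat}.
Implicit Types x y : 'rV[R]_d.

Lemma simplex_le1 x i : simplex R d x -> x 0 i <= 1.
Proof.
by move=> [x0 <-]; rewrite (bigD1 i) //= lerDl sumr_ge0.
Qed.

Lemma simplex_conv x y t : simplex R d x -> simplex R d y ->
  0 <= t -> t <= 1 -> simplex R d ((1 - t) *: x + t *: y).
Proof.
move=> [x0 x1] [y0 y1] t0 t1; split => [i|].
  by rewrite !mxE addr_ge0 // mulr_ge0 ?subr_ge0.
under eq_bigr => i _ do rewrite !mxE.
by rewrite big_split /= -!mulr_sumr x1 y1 !mulr1 subrK.
Qed.

Lemma simplex_polytope : is_polytope (simplex R d).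
Proof.
exists d, (fun i => 'e_i); apply/seteqP; split => [x [x0 x1]|x [a [a0 a1 ->]]].
  by exists (fun i => x 0 i); split => //; exact: row_sum_delta.
have aE i : (\sum_(j < d) a j *: 'e_j : 'rV[R]_d) 0 i = a i.
  rewrite summxE (bigD1 i) //= !mxE !eqxx mulr1 big1 ?addr0// => j ji.
  by rewrite !mxE eq_sym (negbTE ji) mulr0.
by split => [i|]; rewrite ?aE // -a1; apply: eq_bigr => i _; rewrite aE.
Qed.

(* [x] lies in the open segment from [y] to [x + e (x - y)], and the latter is
   still in the simplex for small [e > 0] because [y] vanishes wherever [x]
   does. *)
Lemma simplex_face_spt F x y : is_face (simplex R d) F ->
  simplex R d y -> spt y `<=` spt x -> F x -> F y.
Proof.
move=> [_ sFP faceF] Sy sptyx Fx; have Sx := sFP _ Fx.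
have [[x0 x1] [y0 y1]] := (Sx, Sy).
(* Coordinates are at most 1, so this product is positive and bounds every nonzero coordinate of [x]
   from below. *)
pose e := \prod_(i | x 0 i != 0) x 0 i.
have e0 : 0 < e by apply: prodr_gt0 => i xi; rewrite lt_neqAle eq_sym xi x0.
have ex i : x 0 i != 0 -> e <= x 0 i.
  move=> xi; rewrite /e (bigD1 i) //= ler_piMr // prodr_ile1 // => j _.
  by rewrite x0 simplex_le1.
pose z := x + e *: (x - y).
have Sz : simplex R d z.
  split => [i|].
    rewrite !mxE; have [xi|xi] := eqVneq (x 0 i) 0.
      have -> : y 0 i = 0.
        by apply/eqP/negPn/negP => /sptyx; rewrite /spt /= xi eqxx.
      by rewrite xi subrr mulr0 addr0.
    rewrite mulrBr addrCA addr_ge0 ?mulr_ge0 ?(ltW e0) // subr_ge0.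
    by apply: le_trans (ex _ xi); rewrite ler_piMr ?(ltW e0) ?simplex_le1.
  under eq_bigr => i _ do rewrite !mxE.
  by rewrite big_split /= -mulr_sumr sumrB x1 y1 subrr mulr0 addr0.
have e1 : 1 + e != 0 by rewrite gt_eqF // addr_gt0.
apply: (faceF y z).
- by move=> _ [t /= /andP[/ltW t0 /ltW t1] <-]; exact: simplex_conv.
(* The weight of [z] solves [t * (1 + e) = 1], which cancels the contribution of [y]. *)
- exists x; split => //; exists ((1 + e)^-1) => /=.
    by rewrite invr_gt0 invf_lt1 ?ltrDl ?addr_gt0 // e0.
  by apply/rowP => i; rewrite !mxE; field.
- exists 0; first by rewrite /= lexx ler01.
  by rewrite subr0 scale1r scale0r addr0.
Qed.

End Simplex.

(** * The explicit path [softmin c u] and its support *)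

Section Softmin.
Context {R : realType} {d : nat}.
Implicit Types (x y c : 'rV[R]_d) (u : R).

Definition gap c i : R := c 0 i - minimum [set c 0 j | j in [set: 'I_d]].

Definition weight c u i : R := Num.max 0 (1 - u * gap c i).

Definition mass c u : R := \sum_(i < d) weight c u i.

Definition softmin c u : 'rV[R]_d := \row_i (weight c u i / mass c u).

(* For [u] beyond this value only the coordinates in [argmin c] carry weight;
   the junk value [0^-1 = 0] drops the latter from the sum. *)
Definition freeze c : R := \sum_(i < d) (gap c i)^-1.

Lemma argmin_gap c i : argmin c i <-> gap c i = 0.
Proof.
rewrite /argmin /gap /=; split => [{1}->|/eqP]; first exact: subrr.
by rewrite subr_eq0 => /eqP.
Qed.

Context (d_gt0 : (0 < d)%N).

Lemma gap_min c : (forall i, 0 <= gap c i) /\ exists i, gap c i = 0.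
Proof.
have [i _ imin] :=
  arg_minP (fun j : 'I_d => c 0 j) (erefl : predT (Ordinal d_gt0)).
have minE : minimum [set c 0 j | j in [set: 'I_d]] = c 0 i.
  by apply: minimumE; split => [|_ [j _ <-]]; [exists i|exact: imin].
rewrite /gap minE; split; last by exists i; rewrite subrr.
by move=> j; rewrite subr_ge0 imin.
Qed.

Lemma gap_ge0 c i : 0 <= gap c i.
Proof. exact: (gap_min c).1. Qed.

Lemma freeze_ge0 c : 0 <= freeze c.
Proof. by apply: sumr_ge0 => i _; rewrite invr_ge0 gap_ge0. Qed.

Lemma weight_ge0 c u i : 0 <= weight c u i.
Proof. by rewrite le_max lexx. Qed.

Lemma weight_neq0 c u i : (weight c u i != 0) = (u * gap c i < 1).
Proof.
rewrite -[RHS]subr_gt0 /weight.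
by case: ltP => [/gt_eqF/negbT //|]; rewrite eqxx.
Qed.

Lemma weight_le c u v i : u <= v -> weight c v i <= weight c u i.
Proof.
move=> uv; rewrite /weight ge_max le_max lexx /= le_max; apply/orP; right.
by rewrite lerB // ler_wpM2r // gap_ge0.
Qed.

Lemma mass_le c u v : u <= v -> mass c v <= mass c u.
Proof. by move=> uv; apply: ler_sum => i _; exact: weight_le. Qed.

(** An index with zero gap has weight 1 for every [u]. *)
Lemma mass_ge1 c u : 1 <= mass c u.
Proof.
have [i gi] := (gap_min c).2.
rewrite /mass (bigD1 i) //= {1}/weight gi mulr0 subr0.
rewrite (max_idPr ler01) lerDl sumr_ge0 // => j _; exact: weight_ge0.
Qed.

Lemma mass_gt0 c u : 0 < mass c u.
Proof. exact: lt_le_trans ltr01 (mass_ge1 c u). Qed.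

Lemma simplex_softmin c u : simplex R d (softmin c u).
Proof.
split => [i|]; first by rewrite mxE divr_ge0 ?weight_ge0 // ltW // mass_gt0.
under eq_bigr => i _ do rewrite mxE.
by rewrite -mulr_suml divff // gt_eqF // mass_gt0.
Qed.

Lemma spt_softmin c u i : spt (softmin c u) i <-> u * gap c i < 1.
Proof.
rewrite /spt /= mxE mulf_eq0 invr_eq0 negb_or (gt_eqF (mass_gt0 c u)) andbT.
by rewrite weight_neq0.
Qed.

Lemma spt_softmin_le c u v : u <= v ->
  spt (softmin c v) `<=` spt (softmin c u).
Proof.
move=> uv i /spt_softmin vi; apply/spt_softmin.
by apply: le_lt_trans vi; rewrite ler_wpM2r // gap_ge0.
Qed.

(** The inverse of a nonzero gap is one of the nonnegative summands of [freeze c]. *)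
Lemma freeze_gap c u i : freeze c <= u -> gap c i != 0 -> 1 <= u * gap c i.
Proof.
move=> fu gi; have gi0 : 0 < gap c i by rewrite lt_neqAle eq_sym gi gap_ge0.
rewrite -ler_pdivrMr // mul1r; apply: le_trans fu.
rewrite /freeze (bigD1 i) //= lerDl sumr_ge0 // => j _.
by rewrite invr_ge0 gap_ge0.
Qed.

Lemma spt_softmin_freeze c u : freeze c <= u -> spt (softmin c u) = argmin c.
Proof.
move=> fu; apply/seteqP; split => i; last first.
  by move=> /argmin_gap gi; apply/spt_softmin; rewrite gi mulr0.
move=> /spt_softmin; rewrite ltNge => /negP ui; apply/argmin_gap.
by apply/eqP; apply: contra_notT ui; exact: freeze_gap.
Qed.

(** From [freeze c] on, the weights are the indicator of [argmin c]. *)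
Lemma softmin_freeze c u : freeze c <= u -> softmin c u = softmin c (freeze c).
Proof.
have wE v i : freeze c <= v -> weight c v i = (gap c i == 0)%:R.
  move=> fv; rewrite /weight; case: eqVneq => [->|gi] /=.
    by rewrite mulr0 subr0 (max_idPr ler01).
  by apply/max_idPl; rewrite subr_le0 freeze_gap.
move=> fu; apply/rowP => i; rewrite !mxE !wE //; congr (_ / _).
by apply: eq_bigr => j _; rewrite !wE.
Qed.

(** * Variational characterization of the path *)

Definition potential c u y : R := u * dot c y + mass c u / 2 * dot y y.

(* The weights satisfy the KKT conditions [w_i + u gap_i >= 1], with equality
   on the support, so [softmin c u] minimizes the strongly convex function
   [potential c u]. *)
Lemma softmin_variational c u y : simplex R d y ->
  potential c u (softmin c u)
    + mass c u / 2 * dot (y - softmin c u) (y - softmin c u) <=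
  potential c u y.
Proof.
move=> [y0 y1]; rewrite /potential; have := simplex_softmin c u.
have : forall i, mass c u * softmin c u 0 i = weight c u i.
  by move=> i; rewrite mxE mulrC divfK // gt_eqF // mass_gt0.
move: (softmin c u) => x xE [x0 x1].
pose m := minimum [set c 0 j | j in [set: 'I_d]].
(* Gradient of [potential c u] at [x], shifted by the multiplier [1 + u * m]; the shift is harmless
   because [x] and [y] have equal coordinate sums. *)
pose grad i := u * c 0 i + mass c u * x 0 i - 1 - u * m.
suff : 0 <= \sum_(i < d) grad i * (y 0 i - x 0 i).
  have -> : \sum_(i < d) grad i * (y 0 i - x 0 i) =
     u * (dot c y - dot c x)
     + mass c u / 2 * (dot y y - dot x x - dot (y - x) (y - x)).
    transitivity (\sum_(i < d) (u * c 0 i * y 0 i - u * c 0 i * x 0 i +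
         mass c u * (x 0 i * y 0 i - x 0 i * x 0 i))
         - (1 + u * m) * (\sum_(i < d) y 0 i - \sum_(i < d) x 0 i)).
      rewrite -sumrB mulr_sumr -sumrB; apply: eq_bigr => i _; rewrite /grad; ring.
    rewrite y1 x1 subrr mulr0 subr0 /dot -!sumrB !mulr_sumr -big_split /=.
    by apply: eq_bigr => i _; rewrite !mxE; field.
  by lra.
apply: sumr_ge0 => i _.
rewrite /grad xE; have -> : u * c 0 i + weight c u i - 1 - u * m =
    weight c u i - (1 - u * gap c i) by rewrite /gap -/m; ring.
(* Complementary slackness: off the support [x] vanishes and [grad] is nonnegative; on it [grad]
   vanishes. *)
have [wi|wi] := eqVneq (weight c u i) 0.
  have -> : x 0 i = 0.
    by apply/eqP; move/eqP: (xE i); rewrite wi mulf_eq0 gt_eqF ?mass_gt0.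
  rewrite subr0 mulr_ge0 // subr_ge0.
  by rewrite le_max lexx orbT.
suff -> : weight c u i = 1 - u * gap c i by rewrite subrr mul0r.
by apply/max_idPr; rewrite subr_ge0 ltW // -weight_neq0.
Qed.

Lemma softmin_eq c u y : simplex R d y ->
  potential c u y <= potential c u (softmin c u) ->
  y = softmin c u.
Proof.
move=> Sy le_y; have := softmin_variational c u Sy => var.
apply/eqP; rewrite -subr_eq0; apply/eqP/dot_eq0.
have : 0 < mass c u / 2 by rewrite divr_gt0 // mass_gt0.
set z := dot (y - _) _ in var *; move=> m0.
by rewrite -(pmulr_rle0 _ m0); lra.
Qed.

(** In the ball of radius [enorm (softmin c u)], a competitor of no larger cost has no larger
    potential either. *)
Lemma x_delta_softmin c u : 0 <= u ->
  x_delta (simplex R d) c (enorm (softmin c u)) = softmin c u.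
Proof.
move=> u0; apply: unique_minimizerE.
  by split; [exact: simplex_softmin|].
move=> y [Sy]; rewrite ler_enorm => le_yx le_cy; apply: softmin_eq => //.
have m0 := mass_gt0 c u; rewrite /potential.
by apply: lerD; rewrite ler_wpM2l // divr_ge0 // ltW.
Qed.

(** For [u > 0], multiplying the objective at [eta = u / mass c u] by [u] gives [potential c u]; for
    [u = 0] only the norm term of the potential survives, matching the separate branch of
    [x_fin]. *)
Lemma x_fin_softmin c u : 0 <= u ->
  x_fin (simplex R d) c (u / mass c u) = softmin c u.
Proof.
move=> u0; have m0 := mass_gt0 c u.
rewrite /x_fin mulf_eq0 invr_eq0 (gt_eqF m0) orbF.
have [->|un0] := eqVneq u 0; apply: unique_minimizerE.
- exact: simplex_softmin.
- move=> y Sy; rewrite ler_enorm => le_y; apply: softmin_eq => //.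
  rewrite /potential.
  by rewrite !mul0r !add0r ler_wpM2l // divr_ge0 // ltW // mass_gt0.
- exact: simplex_softmin.
- move=> y Sy le_y; apply: softmin_eq => //.
  rewrite /potential.
  have u_gt0 : 0 < u by rewrite lt_neqAle eq_sym un0.
  move: le_y; rewrite !enorm_sqr.
  have -> : (2 * (u / mass c u))^-1 = mass c u / 2 / u.
    by field; rewrite un0 gt_eqF.
  rewrite -(ler_pM2l u_gt0) !mulrDr.
  by rewrite ![u * (_ / u * _)]mulrA ![u * (_ / u)]mulrC !divfK.
Qed.

(** Each point is tested in the variational inequality of the other. Weighting the inequality at [u]
    by [v] and the one at [v] by [u] cancels the costs, leaving a multiple of [n' - n] whose factor
    is positive because the mass does not increase. *)
Lemma enorm_softmin_le c u v : 0 <= u -> u <= v ->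
  enorm (softmin c u) <= enorm (softmin c v).
Proof.
rewrite [u <= v]le_eqVlt => u0 /predU1P[->//|uv].
rewrite ler_enorm.
have := softmin_variational c u (simplex_softmin c v).
have := softmin_variational c v (simplex_softmin c u); rewrite /potential.
have := mass_gt0 c u; have := mass_gt0 c v; have := mass_le c (ltW uv).
set x := softmin c u; set x' := softmin c v.
have := dot_ge0 (x - x'); have := dot_ge0 (x' - x).
set p := dot (x - x') _; set q := dot (x' - x) _.
set a := dot c x; set b := dot c x'; set n := dot x x; set n' := dot x' x'.
set M := mass c u; set M' := mass c v => q0 p0 MM M'0 M0 e1 e2.
have h1 : 0 <= u * (b - a) + M / 2 * (n' - n) by nra.
have h2 : 0 <= v * (a - b) + M' / 2 * (n - n') by nra.
have : 0 <= (v * M - u * M') * (n' - n).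
  by have := mulr_ge0 u0 h2; have := mulr_ge0 (le_trans u0 (ltW uv)) h1; lra.
rewrite pmulr_rge0 ?subr_ge0 // subr_gt0.
by nra.
Qed.

(** * Continuity in [u], and reaching every admissible [eta] and [delta] *)

Lemma weight_continuous c i : continuous (fun u => weight c u i).
Proof.
move=> u; apply: (@continuous_max R R (fun=> 0) (fun u => 1 - u * gap c i)).
  exact: cst_continuous.
apply: cvgB; first exact: cvg_cst.
by apply: cvgM; [exact: cvg_id|exact: cvg_cst].
Qed.

Lemma mass_continuous c : continuous (mass c).
Proof.
apply: continuous_big => [|i _]; first exact: add_continuous.
exact: weight_continuous.
Qed.

Lemma divr_mass_continuous c (f : R -> R) :
  continuous f -> continuous (fun u => f u / mass c u).
Proof.
move=> fc u; apply: cvgM; first exact: fc.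
by apply: cvgV; [rewrite gt_eqF // mass_gt0|exact: mass_continuous].
Qed.

Lemma enorm_softmin_continuous c : continuous (fun u => enorm (softmin c u)).
Proof.
have dot_cont : continuous (fun u => dot (softmin c u) (softmin c u)).
  apply: continuous_big => [|i _ v /=]; first exact: add_continuous.
  have sc : continuous (fun v => softmin c v 0 i).
    rewrite (_ : (fun v => _) = fun v => weight c v i / mass c v).
      exact: (divr_mass_continuous (@weight_continuous c i)).
    by apply/funext => w; rewrite mxE.
  exact: (cvgM (sc v) (sc v)).
move=> u; exact: (continuous_comp (dot_cont u) (@sqrt_continuous R _)).
Qed.

Lemma softmin_of_eta c (eta : R) : 0 <= eta ->
  exists u, [/\ 0 <= u, eta <= u & u / mass c u = eta].
Proof.
move=> eta0; have m0 := mass_gt0 c.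
have le_b : 0 <= eta * mass c 0 by rewrite mulr_ge0 // ltW.
(* The right endpoint suffices: the mass there is at most [mass c 0], so the quotient is at least
   [eta]. *)
have [|u] := @IVT R (fun u => u / mass c u) 0 (eta * mass c 0) eta le_b
  (continuous_subspaceT (divr_mass_continuous (fun=> cvg_id))).
  rewrite mul0r ge_min eta0 /= le_max; apply/orP; right.
  by rewrite ler_pdivlMr // ler_wpM2l // mass_le.
rewrite in_itv /= => /andP[u0 _] uE; exists u; split => //.
by rewrite -uE ler_pdivrMr // ler_peMr // mass_ge1.
Qed.

Lemma enorm_softmin0_le c x : simplex R d x -> enorm (softmin c 0) <= enorm x.
Proof.
move=> Sx; rewrite ler_enorm; have := softmin_variational c 0 Sx; rewrite /potential.
have := dot_ge0 (x - softmin c 0); set q := dot (x - _) _ => q0.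
rewrite !mul0r !add0r -mulrDr ler_pM2l ?divr_gt0 ?mass_gt0 //.
by lra.
Qed.

Lemma delta_min_simplex c : delta_min (simplex R d) = enorm (softmin c 0).
Proof.
apply: minimumE; split => [|delta [_ [x [Sx]]]].
  split; first exact: enorm_ge0.
  by exists (softmin c 0); split; [exact: simplex_softmin|].
by apply: le_trans; exact: enorm_softmin0_le.
Qed.

Lemma softmin_freeze_min c y : simplex R d y ->
  dot c (softmin c (freeze c)) <= dot c y.
Proof.
pose m := minimum [set c 0 j | j in [set: 'I_d]].
(* On the simplex the cost exceeds [m] by the gap term, which vanishes for points supported in
   [argmin c]. *)
have gE x : simplex R d x -> dot c x = m + \sum_(i < d) gap c i * x 0 i.
  move=> [_ x1]; rewrite -[m]mulr1 -x1 mulr_sumr -big_split.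
  by apply: eq_bigr => i _; rewrite /= /gap -/m -mulrDl addrC subrK.
move=> Sy; rewrite !gE //; last exact: simplex_softmin.
rewrite lerD2l big1 => [|i _].
  by apply: sumr_ge0 => i _; rewrite mulr_ge0 ?gap_ge0 //; case: Sy.
have [->|gi] := eqVneq (gap c i) 0; first by rewrite mul0r.
apply/eqP; rewrite mulf_eq0 (negbTE gi) /=; apply/negPn/negP => xi.
have : spt (softmin c (freeze c)) i by [].
by rewrite spt_softmin_freeze // => /argmin_gap/eqP; exact/negP.
Qed.

Lemma delta_max_simplex c :
  delta_max (simplex R d) c = enorm (softmin c (freeze c)).
Proof.
have Sf := simplex_softmin c (freeze c).
apply: minimumE; split => [|delta [_ [m [[x [Sx le_x] <-] _] [_ xmin]]]].
  split; first exact: enorm_ge0.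
  exists (dot c (softmin c (freeze c))); split.
  - by exists (softmin c (freeze c)) => //; split.
  - by move=> _ [y [Sy _] <-]; exact: softmin_freeze_min.
  - by exists (softmin c (freeze c)).
  - by move=> _ [y Sy <-]; exact: softmin_freeze_min.
(* A shorter optimal [x] would have potential at [freeze c] no larger than that of the path point,
   hence coincide with it. *)
apply: le_trans le_x; rewrite leNgt; apply/negP => lt_x.
move: (lt_x); suff -> : x = softmin c (freeze c) by rewrite ltxx.
apply: softmin_eq => //; rewrite /potential; apply: lerD.
  by rewrite ler_wpM2l ?freeze_ge0 // xmin //; exists (softmin c (freeze c)).
by rewrite ler_wpM2l -?ler_enorm ?(ltW lt_x) // divr_ge0 // ltW // mass_gt0.
Qed.

Lemma softmin_of_delta c delta :
  delta_min (simplex R d) <= delta -> delta <= delta_max (simplex R d) c ->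
  exists2 u, 0 <= u & delta = enorm (softmin c u).
Proof.
rewrite (delta_min_simplex c) delta_max_simplex => ge_delta le_delta.
have [|u] := @IVT R (fun u => enorm (softmin c u)) 0 (freeze c) delta
  (freeze_ge0 c) (continuous_subspaceT (@enorm_softmin_continuous c)).
  by rewrite ge_min ge_delta /= le_max le_delta orbT.
by rewrite in_itv /= => /andP[u0 _] <-; exists u.
Qed.

(** * Monotonicity of the supports in [delta] and [eta] *)

Lemma x_delta_spt c delta delta' :
  delta_min (simplex R d) <= delta -> delta <= delta' ->
  delta' <= delta_max (simplex R d) c ->
  simplex R d (x_delta (simplex R d) c delta') /\
  spt (x_delta (simplex R d) c delta') `<=` spt (x_delta (simplex R d) c delta).
Proof.
move=> ge_delta dd' le_delta'.
have [u u0 uE] := softmin_of_delta ge_delta (le_trans dd' le_delta').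
have [v v0 vE] := softmin_of_delta (le_trans ge_delta dd') le_delta'.
have xv : x_delta (simplex R d) c delta' = softmin c v.
  by rewrite vE x_delta_softmin.
split; first by rewrite xv; exact: simplex_softmin.
(* The norm need not be injective in [u], so the two parameters may come in the wrong order;
   monotonicity of the norm then forces [delta = delta']. *)
have [uv|/ltW vu] := leP u v.
  by rewrite xv uE x_delta_softmin //; exact: spt_softmin_le.
suff -> : delta = delta' by [].
by apply/eqP; rewrite eq_le dd' uE vE enorm_softmin_le.
Qed.

(** The family is eventually constant: [eta <= u] pushes [u] past [freeze c]. *)
Lemma x_eta_infty c :
  x_eta (simplex R d) c +oo%E = softmin c (freeze c).
Proof.
rewrite /x_eta; apply: lim_near_cst; first exact: norm_hausdorff.
near=> r; have r0 : 0 <= r by near: r; exact: nbhs_pinfty_ge.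
have [u [u0 ru <-]] := softmin_of_eta c r0.
rewrite x_fin_softmin // softmin_freeze //; apply: le_trans ru.
by near: r; apply: nbhs_pinfty_ge; exact: num_real.
Unshelve. all: by end_near. Qed.

Lemma x_eta_spt c (eta eta' : \bar R) : (0 <= eta)%E -> (eta <= eta')%E ->
  simplex R d (x_eta (simplex R d) c eta') /\
  spt (x_eta (simplex R d) c eta') `<=` spt (x_eta (simplex R d) c eta).
Proof.
move=> eta0 le_eta; have le_eta' := le_trans eta0 le_eta.
case: eta' eta le_eta le_eta' eta0 => [r'||] [r||] //= rr' r'0 r0.
- have [u [u0 _ uE]] := softmin_of_eta c r0.
  have [v [v0 _ vE]] := softmin_of_eta c r'0.
  rewrite -uE -vE !x_fin_softmin //; split; first exact: simplex_softmin.
  (* Here the order of the parameters is determined: [u / mass c u] is strictly increasing on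
     [u >= 0]. *)
  apply: spt_softmin_le; rewrite leNgt; apply/negP => vu.
  move: rr'; rewrite lee_fin -uE -vE leNgt => /negP; apply.
  apply: lt_le_trans (_ : u / mass c v <= _).
    by rewrite ltr_pM2r // invr_gt0 mass_gt0.
  by rewrite ler_wpM2l // lef_pV2 ?posrE ?mass_gt0 // mass_le // ltW.
- rewrite -[lim _]/(x_eta _ _ +oo%E) x_eta_infty.
  split; first exact: simplex_softmin.
  have [u [u0 _ <-]] := softmin_of_eta c r0; rewrite x_fin_softmin //.
  have [uf|fu] := leP u (freeze c); first exact: spt_softmin_le.
  by rewrite (softmin_freeze (ltW fu)).
- rewrite -[lim _]/(x_eta _ _ +oo%E) x_eta_infty.
  by split; first exact: simplex_softmin.
Qed.

End Softmin.

Theorem corollary4p1 (R : realType) (d : nat) (hd : (1 <= d)%N) :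
  monotone_polytope (simplex R d) /\
  monotone_polytope_eta (simplex R d) /\
  (forall c : 'rV[R]_d,
     spt_delta_decreases_to_argmin (simplex R d) c /\
     spt_eta_decreases_to_argmin (simplex R d) c).
Proof.
have S0 : simplex R d !=set0 by exists (softmin 0 0); exact: simplex_softmin.
split; [|split].
- split=> // [|c F faceF delta delta' h1 h2 h3]; first exact: simplex_polytope.
  by have [S' sub] := x_delta_spt hd h1 h2 h3; exact: simplex_face_spt S' sub.
- split=> // [|c F faceF eta eta' h1 h2]; first exact: simplex_polytope.
  by have [S' sub] := x_eta_spt hd c h1 h2; exact: simplex_face_spt S' sub.
move=> c; split; split.
- by move=> delta delta' h1 h2 h3; exact: (x_delta_spt hd h1 h2 h3).2.
- rewrite delta_max_simplex // x_delta_softmin ?freeze_ge0 //.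
  exact: spt_softmin_freeze.
- move=> eta eta' h1 h2.
  by apply: (x_eta_spt hd c _ _).2; rewrite lee_fin.
(* A threshold for [u] also serves for [eta], since the [u] reaching [eta] satisfies [eta <= u]. *)
exists (freeze c) => [|eta le_eta]; first exact: freeze_ge0.
have [u [u0 le_u <-]] := softmin_of_eta hd c (le_trans (freeze_ge0 hd c) le_eta).
by rewrite /x_eta x_fin_softmin // spt_softmin_freeze // (le_trans le_eta).
Qed.
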